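(* Let a hermitian structure $\Lambda$ on $\mathcal{E}$ be fixed, and consider the action $S(\nabla,\xi)=\mathrm{YM}(\nabla)+E_\nabla(\xi)-m^2\|\xi\|^2$ for $\Lambda$-hermitian connections $\nabla$ on $\mathcal{E}$ and sections $\xi\in\mathcal{E}$. The Euler-Lagrange equations for the action $S=S(\nabla,\xi)$ have the form $$d_\nabla^*\nabla^2=-J,\qquad \nabla^*\nabla\xi=m^2\xi .$$
   Context: Variations. The Euler-Lagrange equations are those obtained from the variation of $S$ under $\nabla\mapsto\nabla+\delta\nabla$ and $\xi\mapsto\xi+\delta\xi$, keeping only terms linear in $\delta\nabla,\delta\xi$, where $\delta\xi\in\mathcal{E}$ and the connection $\nabla+\delta\nabla$ is always assumed to be $\Lambda$-hermitian. Setting. $\mathcal{H}$ is a finite-dimensional complex Hilbert space; $\mathcal{A}$ is a unital involutive algebra of operators on $\mathcal{H}$ (not necessarily commutative); $ds\in L(\mathcal{H})$ is selfadjoint and invertible with $[ds^2,a]=0$ for all $a\in\mathcal{A}$; $D=ds^{-1}$. For $a\in\mathcal{A}$, $da:=i[D,a]$. $\Omega^k\subset L(\mathcal{H})$ consists of the operators $\sum_j a_0^j\,da_1^j\cdots da_k^j$, $a_i^j\in\mathcal{A}$ ($\Omega^0=\mathcal{A}$), and $d:\Omega^k\to\Omega^{k+1}$ is $d(\sum_j a_0^jda_1^j\cdots da_k^j)=\sum_j da_0^jda_1^j\cdots da_k^j$. On $\Omega^k$, $\langle\omega,\omega'\rangle=\mathrm{Tr}(\omega'^*\omega)$, and $d^*$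 is the adjoint of $d$: $\langle d^*\sigma,\omega\rangle=\langle\sigma,d\omega\rangle$. All tensor products of modules are over $\mathcal{A}$. Module. $\mathcal{E}$ is a trivial (free rank one) right $\mathcal{A}$-module with a distinguished class of bases, permuted simply transitively by $u\in\mathcal{U}=\{u\in\mathcal{A}:u^*u=uu^*=1\}$ via $e\mapsto eu^*$; below $e$ is such a basis. A hermitian structure $\Lambda$ is given in the basis $e$ by a positive invertible $\lambda\in\mathcal{A}$ ($\lambda'=u\lambda u^*$ for $eu^*$): $(ea,eb)_\Lambda=b^*\lambda a$. $\hat{\mathcal{E}}$ is the left $\mathcal{A}$-module of $\mathcal{A}$-linear homomorphisms $\mathcal{E}\to\mathcal{A}$; $\wedge e\in\hat{\mathcal{E}}$ is given by $(\wedge e)(ea)=a$. Put $(a\wedge e,b\wedge e)_\Lambda=a\lambda b^*$ and $\hat e=\lambda^{-1}\wedge e$. Hermitian metrics: on $\mathcal{E}$, $\langle\xi,\eta\rangle=\mathrm{Tr}\,(\xi,\eta)_\Lambda$; on $\mathcal{E}\otimes\Omega^k$, $\langle\xi\otimes\omega,\xi'\otimes\omega'\rangle=\langle\omega,(\xi,\xi')_\Lambda\omega'\rangle$; on $\mathcal{E}\otimes\Omega^k\otimes\hat{\mathcal{E}}$, $\langle\xi\otimes\omega\otimes\zeta,\xi'\otimes\omega'\otimes\zeta'\rangle=\langle\omega(\zeta,\zeta')_\Lambda,(\xi,\xi')_\Lambda\omega'\rangle$. The space $\mathcal{E}\otimes\Omega^k\otimes\hat{\mathcal{E}}$ is identified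 with the right $\mathcal{A}$-linear maps $\mathcal{E}\to\mathcal{E}\otimes\Omega^k$ by $(\xi\otimes\omega\otimes\zeta)(\eta)=\xi\otimes\omega\,\zeta(\eta)$. Connections. A connection is a linear map $\nabla:\mathcal{E}\to\mathcal{E}\otimes\Omega^1$ with $\nabla(\xi a)=(\nabla\xi)a+\xi\otimes da$; it is determined by $\Phi\in\Omega^1$ with $\nabla e=e\otimes\Phi$. It is $\Lambda$-hermitian if $d\lambda=\lambda\Phi+\Phi^*\lambda$. It extends by $\nabla(e\otimes\omega)=e\otimes(\Phi\omega+d\omega)$; its curvature $\nabla^2=\nabla\circ\nabla$ is $\mathcal{A}$-linear, $\nabla^2=e\otimes\theta\otimes\wedge e$ with $\theta=d\Phi+\Phi^2\in\Omega^2$. $\mathrm{YM}(\nabla)=\langle\nabla^2,\nabla^2\rangle$, $E_\nabla(\xi)=\langle\nabla\xi,\nabla\xi\rangle$, $\|\xi\|^2=\langle\xi,\xi\rangle$, and $m$ is a real number (the mass of $\xi$). Further objects. For $\xi\in\mathcal{E}$ the element $\hat\xi\in\hat{\mathcal{E}}$ is defined by $\langle\omega,\gamma(\xi)\rangle=\langle\omega\otimes\hat\xi,\gamma\rangle$ for all $\omega\in\mathcal{E}\otimes\Omega^k$, $\gamma\in\mathcal{E}\otimes\Omega^k\otimes\hat{\mathcal{E}}$; for $\xi=ea$ one has $\hat\xi=a^*\hat e$. The connection $\hat\nabla:\hat{\mathcal{E}}\to\Omega^1\otimes\hat{\mathcal{E}}$ is defined by $\hat\nabla\hat e=\Phi^*\otimes\hat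 e$ and the left Leibniz rule $\hat\nabla(b\zeta)=db\otimes\zeta+b\hat\nabla\zeta$. The current is $J=J(\nabla,\xi)=\nabla\xi\otimes\hat\xi-\xi\otimes\hat\nabla\hat\xi\in\mathcal{E}\otimes\Omega^1\otimes\hat{\mathcal{E}}$. $\nabla^*:\mathcal{E}\otimes\Omega^1\to\mathcal{E}$ is the adjoint of $\nabla$. The operator $d_\nabla^*:\mathcal{E}\otimes\Omega^2\otimes\hat{\mathcal{E}}\to\mathcal{E}\otimes\Omega^1\otimes\hat{\mathcal{E}}$ is defined by $d_\nabla^*(e\otimes\sigma\otimes\hat e)=e\otimes(\omega-\omega^* )\otimes\hat e$, where $\omega=d^*\sigma+\sigma\Phi^*-\Phi\sigma$. These definitions do not depend on the choice of the basis $e$.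
   Formalization: In d_∇^*, ω is the orthogonal projection onto Ω^1 of d^*σ+σΦ^*−Φσ, which as written need not lie in Ω^1 (the literal equation can fail at critical points); the metric on E⊗Ω^k is the given formula on e⊗ω, extended by A-balancedness. *)

(* Defs.v *)
From HB Require Import structures.
From mathcomp Require Import all_boot all_order all_algebra.
From mathcomp Require Import sesquilinear spectral complex.
From mathcomp Require Import boolp classical_sets reals topology normedtype derive.

Set Implicit Arguments.
Unset Strict Implicit.
Unset Printing Implicit Defensive.

Import Order.TTheory GRing.Theory Num.Theory.
Import numFieldNormedType.Exports.

Local Open Scope classical_set_scope.
Local Open Scope ring_scope.
Local Open Scope complex_scope.
Local Open Scope sesquilinear_scope.

(* The Hilbert space is C^n with C = R[i], its operators are 'M[C]_n acting on
   column vectors, and the Hilbert space adjoint of a is a ^t*. *)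

Record geometry (R : realType) (n : nat) := Geometry {
  alg : set 'M[R[i]]_n;
  len : 'M[R[i]]_n;
  alg1 : alg 1%:M;
  algP : forall (c : R[i]) a b, alg a -> alg b -> alg (c *: a + b);
  algM : forall a b, alg a -> alg b -> alg (a *m b);
  alg_adj : forall a, alg a -> alg (a ^t* );
  len_adj : len ^t* = len;
  len_unit : len \in unitmx;
  len2_comm : forall a, alg a -> (len *m len) *m a = a *m (len *m len)
}.

Section Forms.
Context {R : realType} {n : nat} (G : geometry R n).
Local Notation Op := 'M[R[i]]_n.

Definition dirac : Op := invmx (len G).

Definition da (a : Op) : Op := 'i *: (dirac *m a - a *m dirac).

Definition daprod (s : seq Op) : Op := \big[mulmx/1%:M]_(b <- s) da b.

(* A family of words (a_0, (a_1, ..., a_k)), standing for the formal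
   expression sum_j a_0^j da_1^j ... da_k^j. *)
Definition words (k : nat) (s : seq (Op * k.-tuple Op)) : Prop :=
  forall p, p \in s -> alg G p.1 /\ (forall b, b \in p.2 -> alg G b).

Definition Omega (k : nat) : set Op :=
  [set w | exists s : seq (Op * k.-tuple Op),
     words s /\ w = \sum_(p <- s) p.1 *m daprod p.2].

(* The value does not depend on the chosen expression of w, because D^2
   commutes with the algebra. *)
Definition d (k : nat) (w : Op) : Op :=
  xget 0 [set w' | exists s : seq (Op * k.-tuple Op),
    [/\ words s, w = \sum_(p <- s) p.1 *m daprod p.2
      & w' = \sum_(p <- s) da p.1 *m daprod p.2]].

Definition opdot (w w' : Op) : R[i] := \tr (w' ^t* *m w).

Definition proj (k : nat) (x : Op) : Op :=
  xget 0 [set t | Omega k t /\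
    forall w, Omega k w -> opdot t w = opdot x w].

(* The adjoint of d on Omega^k, defined on s in Omega^(k+1). *)
Definition dstar (k : nat) (s : Op) : Op :=
  xget 0 [set t | Omega k t /\
    forall w, Omega k w -> opdot t w = opdot s (d k w)].

Definition unitary_of (u : Op) : Prop :=
  [/\ alg G u, u ^t* *m u = 1%:M & u *m u ^t* = 1%:M].

Definition positive_op (a : Op) : Prop :=
  a ^t* = a /\ forall v : 'cV[R[i]]_n, 0 <= (v ^t* *m a *m v) 0 0.

End Forms.

(* A free right module of rank one with its distinguished class of bases.
   [act x a] is the product x a; it is only meaningful for a in the algebra. *)
Record framed_module (R : realType) (n : nat) (G : geometry R n) :=
  FramedModule {
  carrier :> lmodType R[i];
  act : carrier -> 'M[R[i]]_n -> carrier;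
  frames : set carrier;
  act_linl : forall (c : R[i]) x y a, alg G a ->
    act (c *: x + y) a = c *: act x a + act y a;
  act_linr : forall (c : R[i]) x a b, alg G a -> alg G b ->
    act x (c *: a + b) = c *: act x a + act x b;
  act1 : forall x, act x 1%:M = x;
  actM : forall x a b, alg G a -> alg G b -> act (act x a) b = act x (a *m b);
  frames_nonempty : exists e, frames e;
  frames_basis : forall e, frames e ->
    forall x, exists! a, alg G a /\ x = act e a;
  frames_stable : forall e u, frames e -> unitary_of G u ->
    frames (act e (u ^t* ));
  frames_transitive : forall e e', frames e -> frames e' ->
    exists! u, unitary_of G u /\ e' = act e (u ^t* )
}.

Section Balanced.
Context {R : realType} {n : nat} (G : geometry R n) (E : framed_module G).
Local Notation Op := 'M[R[i]]_n.

Definition balanced (k : nat) (V : lmodType R[i]) (f : E -> Op -> V) : Prop :=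
  [/\ forall (c : R[i]) x y w, Omega G k w ->
        f (c *: x + y) w = c *: f x w + f y w,
      forall (c : R[i]) x w w', Omega G k w -> Omega G k w' ->
        f x (c *: w + w') = c *: f x w + f x w'
    & forall x a w, alg G a -> Omega G k w -> f (act x a) w = f x (a *m w)].

End Balanced.

(* The tensor products E (x)_A Omega^k, as right A-modules.  They are given by
   their universal property; uniqueness of the factorization follows from
   [tens_span]. *)
Record tensors (R : realType) (n : nat) (G : geometry R n)
    (E : framed_module G) := Tensors {
  tcar :> nat -> lmodType R[i];
  tens : forall k, E -> 'M[R[i]]_n -> tcar k;
  tact : forall k, tcar k -> 'M[R[i]]_n -> tcar k;
  tens_balanced : forall k, balanced k (@tens k);
  tens_span : forall k (t : tcar k), exists s : seq (E * 'M[R[i]]_n),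
    (forall p, p \in s -> Omega G k p.2) /\ t = \sum_(p <- s) tens k p.1 p.2;
  tens_universal : forall k (V : lmodType R[i]) (f : E -> 'M[R[i]]_n -> V),
    balanced k f -> exists g : {linear tcar k -> V},
      forall x w, Omega G k w -> g (tens k x w) = f x w;
  tact_lin : forall k (c : R[i]) (t t' : tcar k) a, alg G a ->
    tact (c *: t + t') a = c *: tact t a + tact t' a;
  tact_tens : forall k x w a, Omega G k w -> alg G a ->
    tact (tens k x w) a = tens k x (w *m a)
}.

Section Gauge.
Context {R : realType} {n : nat} {G : geometry R n} {E : framed_module G}.
Context (T : tensors E) (L : E -> E -> 'M[R[i]]_n) (e : E).
Local Notation Op := 'M[R[i]]_n.

(* L x y is (x, y)_Lambda; in a basis e, lambda is L e e. *)
Definition hermitian_structure : Prop :=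
  forall f : E, frames f ->
    [/\ alg G (L f f), positive_op (L f f), L f f \in unitmx
      & forall a b, alg G a -> alg G b ->
          L (act f a) (act f b) = b ^t* *m L f f *m a].

Let lam : Op := L e e.

Definition dual (z : E -> Op) : Prop :=
  [/\ forall x, alg G (z x),
      forall (c : R[i]) x y, z (c *: x + y) = c *: z x + z y
    & forall x a, alg G a -> z (act x a) = z x *m a].

Definition wedge (x : E) : Op := xget 0 [set a | alg G a /\ x = act e a].

Definition ehat (x : E) : Op := invmx lam *m wedge x.

(* (a /\e, b /\e)_Lambda = a lambda b^*, where a = (a /\e)(e). *)
Definition dual_form (z z' : E -> Op) : Op := z e *m lam *m (z' e) ^t*.

Definition edot (x y : E) : R[i] := \tr (L x y).

(* The form w with t = e (x) w. *)
Definition tcoord (k : nat) (t : T k) : Op :=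
  xget 0 [set w | Omega G k w /\ t = tens T k e w].

(* The metric on E (x) Omega^k, evaluated on e (x) w and e (x) w'. *)
Definition tdot (k : nat) (t t' : T k) : R[i] :=
  opdot (tcoord t) (lam *m tcoord t').

(* E (x) Omega^k (x) E^ is the space of right A-linear maps
   E -> E (x) Omega^k. *)
Definition hom (k : nat) (g : E -> T k) : Prop :=
  (forall (c : R[i]) x y, g (c *: x + y) = c *: g x + g y) /\
  (forall x a, alg G a -> g (act x a) = tact (g x) a).

Definition tens_dual (k : nat) (t : T k) (z : E -> Op) : E -> T k :=
  fun x => tact t (z x).

(* The form w with g = e (x) w (x) z, for z a generator of the dual. *)
Definition hcoord (k : nat) (z : E -> Op) (g : E -> T k) : Op :=
  xget 0 [set w | Omega G k w /\ g = tens_dual (tens T k e w) z].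

(* The metric on E (x) Omega^k (x) E^, evaluated on e (x) w (x) /\e and
   e (x) w' (x) /\e. *)
Definition hdot (k : nat) (g g' : E -> T k) : R[i] :=
  opdot (hcoord wedge g *m dual_form wedge wedge) (lam *m hcoord wedge g').

Definition connection (nabla : E -> T 1) : Prop :=
  (forall (c : R[i]) x y, nabla (c *: x + y) = c *: nabla x + nabla y) /\
  (forall x a, alg G a ->
     nabla (act x a) = tact (nabla x) a + tens T 1 x (da G a)).

Definition potential (nabla : E -> T 1) : Op := tcoord (nabla e).

Definition hermitian_connection (nabla : E -> T 1) : Prop :=
  connection nabla /\
  da G lam = lam *m potential nabla + (potential nabla) ^t* *m lam.

Definition extension (nabla : E -> T 1) (k : nat) (t : T k) : T k.+1 :=
  tens T k.+1 e (potential nabla *m tcoord t + d G k (tcoord t)).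

Definition curvature (nabla : E -> T 1) : E -> T 2 :=
  fun x => extension nabla (nabla x).

(* The three quantities below are real, and Re reads them in R. *)
Definition YM (nabla : E -> T 1) : R :=
  complex.Re (hdot (curvature nabla) (curvature nabla)).

Definition energy (nabla : E -> T 1) (x : E) : R :=
  complex.Re (tdot (nabla x) (nabla x)).

Definition sqnorm (x : E) : R := complex.Re (edot x x).

Definition action (m : R) (nabla : E -> T 1) (x : E) : R :=
  YM nabla + energy nabla x - m ^+ 2 * sqnorm x.

(* The part of the action linear in (dnabla, dxi) vanishes for all variations
   that keep the connection hermitian. *)
Definition euler_lagrange (m : R) (nabla : E -> T 1) (xi : E) : Prop :=
  forall (dnabla : E -> T 1) (dxi : E),
    hermitian_connection (fun x => nabla x + dnabla x) ->
    is_derive (0 : R) (1 : R)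
      (fun t : R => action m (fun x => nabla x + t%:C *: dnabla x)
                             (xi + t%:C *: dxi)) 0.

Definition hat (xi : E) : E -> Op :=
  xget (fun=> 0) [set z | dual z /\
    forall k (w : T k) (g : E -> T k), hom g ->
      tdot w (g xi) = hdot (tens_dual w z) g].

(* nabla^ on the dual, with values in Omega^1 (x) E^ seen as maps
   E -> Omega^1: nabla^ (b e^) = db (x) e^ + b Phi^* (x) e^. *)
Definition nabla_hat (nabla : E -> T 1) (z : E -> Op) : E -> Op :=
  let b := xget 0 [set b | alg G b /\ z = (fun x => b *m ehat x)] in
  fun x => (da G b + b *m (potential nabla) ^t* ) *m ehat x.

Definition current (nabla : E -> T 1) (xi : E) : E -> T 1 :=
  fun x => tens_dual (nabla xi) (hat xi) x
           - tens T 1 xi (nabla_hat nabla (hat xi) x).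

Definition nabla_star (nabla : E -> T 1) (t : T 1) : E :=
  xget 0 [set x | forall y : E, edot x y = tdot t (nabla y)].

(* For sigma in Omega^2 the operators sigma Phi^* and Phi sigma belong to
   Omega^3, which need not be contained in Omega^1 inside L(H); d_nabla^* takes
   values in E (x) Omega^1 (x) E^, so omega is the Omega^1-component of
   d^* sigma + sigma Phi^* - Phi sigma.  The orthogonal projection is
   A-bilinear and commutes with adjoints; hence it does not depend on e and
   is also orthogonal for the metric of E (x) Omega^1 (x) E^. *)
Definition dnabla_star (nabla : E -> T 1) (g : E -> T 2) : E -> T 1 :=
  let Phi := potential nabla in
  let sigma := hcoord ehat g in
  let omega := proj G 1 (dstar G 1 sigma + sigma *m Phi ^t* - Phi *m sigma) in
  tens_dual (tens T 1 e (omega - omega ^t* )) ehat.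

End Gauge.

(* Main.v *)
Require Import Defs.
From HB Require Import structures.
From mathcomp Require Import all_boot all_order all_algebra.
From mathcomp Require Import sesquilinear spectral complex.
From mathcomp Require Import boolp classical_sets reals topology normedtype derive.
From mathcomp Require Import ring.

(* In the basis e, with xi = e a, nabla xi = e (x) w and curvature
   e (x) theta (x) /\e, a variation of the connection is a form phi such that
   beta = lambda phi is antihermitian, and theta varies by
   theta' = d phi + Phi phi + phi Phi.  Hermiticity of nabla gives
   lambda theta' = d beta - Phi^* beta + beta Phi, so that with
   sigma = theta lambda (the coordinate of the curvature along e^) the pairing
   of the curvature with its variation is <omega, beta>, where
   omega = d^* sigma + sigma Phi^* - Phi sigma.  The energy contributes
   <w a^*, beta>.  As beta is antihermitian, only the antihermitian part
   omega - omega^* + w a^* - a w^* of the sum matters; it is itself an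
   admissible beta, so it must vanish, and this is the first equation.  The
   variation of xi gives Re <nabla xi, nabla y> = m^2 Re <xi, y> for all y;
   replacing y by i y removes Re. *)

Import GRing.Theory Num.Theory.
Import numFieldNormedType.Exports.
Local Open Scope ring_scope.
Local Open Scope complex_scope.
Local Open Scope sesquilinear_scope.

(** * Conjugate transposes of complex matrices *)

Section Adjoint.
Context {C : numClosedFieldType}.

Lemma trmxCD m n (A B : 'M[C]_(m, n)) : (A + B)^t* = A^t* + B^t*.
Proof. by rewrite linearD /= map_mxD. Qed.

Lemma trmxCN m n (A : 'M[C]_(m, n)) : (- A)^t* = - A^t*.
Proof. by rewrite linearN /= map_mxN. Qed.

Lemma trmxCZ m n (c : C) (A : 'M[C]_(m, n)) : (c *: A)^t* = (c^*)%R *: A^t*.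
Proof. by rewrite linearZ /= map_mxZ. Qed.

Lemma trmxCM m n p (A : 'M[C]_(m, n)) (B : 'M[C]_(n, p)) :
  (A *m B)^t* = B^t* *m A^t*.
Proof. by rewrite trmx_mul map_mxM. Qed.

Lemma trmxC1 n : (1%:M : 'M[C]_n)^t* = 1%:M.
Proof. by rewrite trmx1 map_mx1. Qed.

Lemma mxtrace_adj n (A : 'M[C]_n) : \tr (A^t*) = ((\tr A)^*)%R.
Proof. by rewrite /mxtrace rmorph_sum; apply: eq_bigr => i _; rewrite !mxE. Qed.

End Adjoint.

Lemma addmxE {V : nmodType} m n (A B : 'M[V]_(m, n)) i j : (A + B) i j = A i j + B i j.
Proof. by rewrite mxE. Qed.

Lemma oppmxE {V : zmodType} m n (A : 'M[V]_(m, n)) i j : (- A) i j = - A i j.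
Proof. by rewrite mxE. Qed.

(** * Subspaces given as predicates *)

Section Subspace.
Context {K : fieldType} {V : vectType K} (S : set V).
Hypothesis (S0 : S 0) (SP : forall c x y, S x -> S y -> S (c *: x + y)).

(** A subspace of maximal dimension inside S exhausts S, because adjoining a missing element of S
    would raise the dimension. This makes dimension counts and bases available for [alg] and
    [Omega]. *)
Lemma vspace_of_set : exists U : {vspace V}, forall x, S x <-> x \in U.
Proof.
pose P k := `[< exists2 U : {vspace V}, (forall x, x \in U -> S x) & \dim U = k >].
have exP : exists k, P k.
  exists 0; apply/asboolP; exists 0%VS; last by rewrite dimv0.
  by move=> x; rewrite memv0 => /eqP ->.
have ubP k : P k -> (k <= \dim {:V})%N.
  by move=> /asboolP [U _ <-]; rewrite dimvS ?subvf.
case: (ex_maxnP exP ubP) => k /asboolP [U US <-] maxU.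
exists U => x; split=> [Sx|]; last exact: US.
have: P (\dim (U + <[x]>)).
  apply/asboolP; exists (U + <[x]>)%VS => // y /memv_addP [u uU [v /vlineP [c ->] ->]].
  by rewrite addrC; apply: SP => //; exact: US.
move=> /maxU le_dim.
have := dimv_leqif_eq (addvSl U <[x]>%VS).
case=> le'; rewrite eqn_leq le' le_dim => /esym /eqP ->.
by apply: (subvP (addvSr _ _)); rewrite memv_line.
Qed.

End Subspace.

(** * The trace pairing of operators and orthogonal projection *)

Section Pairing.
Context {R : realType} {n : nat}.
Local Notation Op := 'M[R[i]]_n.
Implicit Types (x y w : Op) (c : R[i]).

Lemma opdotDl x y w : opdot (x + y) w = opdot x w + opdot y w.
Proof. by rewrite /opdot mulmxDr linearD. Qed.

Lemma opdotNl x w : opdot (- x) w = - opdot x w.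
Proof. by rewrite /opdot mulmxN linearN. Qed.

Lemma opdotZl c x w : opdot (c *: x) w = c * opdot x w.
Proof. by rewrite /opdot -scalemxAr linearZ. Qed.

Lemma opdotC x y : opdot x y = ((opdot y x)^*)%R.
Proof. by rewrite /opdot -mxtrace_adj trmxCM trmxCK. Qed.

Lemma opdotDr x y w : opdot w (x + y) = opdot w x + opdot w y.
Proof. by rewrite opdotC opdotDl rmorphD /= -!opdotC. Qed.

Lemma opdotNr x w : opdot w (- x) = - opdot w x.
Proof. by rewrite opdotC opdotNl rmorphN /= -opdotC. Qed.

Lemma opdotZr c x w : opdot w (c *: x) = (c^*)%R * opdot w x.
Proof. by rewrite opdotC opdotZl rmorphM /= -opdotC. Qed.

Lemma opdot0r w : opdot w 0 = 0.
Proof. by rewrite /opdot trmx0 map_mx0 mul0mx linear0. Qed.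

Lemma opdotMl a x y : opdot (a *m x) y = opdot x (a^t* *m y).
Proof. by rewrite /opdot trmxCM trmxCK mulmxA. Qed.

Lemma opdotMr a x y : opdot (x *m a) y = opdot x (y *m a^t*).
Proof. by rewrite /opdot trmxCM trmxCK mulmxA mxtrace_mulC !mulmxA. Qed.

(** The trace of x x^* is the sum of the squared moduli of the entries of x. *)
Lemma opdot_eq0 x : opdot x x = 0 -> x = 0.
Proof.
rewrite /opdot mxtrace_mulC /mxtrace => /eqP; rewrite psumr_eq0; last first.
  move=> i _; rewrite mxE; apply: sumr_ge0 => j _.
  by rewrite !mxE mul_conjC_ge0.
move=> /allP x0; apply/matrixP=> i j; move/(_ i (mem_index_enum _)): x0 => /=.
rewrite mxE psumr_eq0 => [/allP/(_ j (mem_index_enum _)) /=|k _].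
  by rewrite !mxE mul_conjC_eq0 => /eqP.
by rewrite !mxE mul_conjC_ge0.
Qed.

Lemma opdot_Re0 x : complex.Re (opdot x x) = 0 -> x = 0.
Proof.
move=> Re0; apply: opdot_eq0; have := opdotC x x.
case: (opdot x x) Re0 => a b /= -> [b0].
suff -> : b = 0 by [].
by apply/eqP; rewrite -eqNr -b0.
Qed.

Lemma Re_opdotC x y : complex.Re (opdot x y) = complex.Re (opdot y x).
Proof. by rewrite opdotC; case: (opdot y x). Qed.

(** Taking adjoints conjugates the pairing. Hermitian and antihermitian operators are therefore
    orthogonal for its real part. *)
Lemma Re_opdot_adj x y : complex.Re (opdot (x^t*) (y^t*)) = complex.Re (opdot x y).
Proof.
rewrite /opdot trmxCK mxtrace_mulC -(trmxCK x) -trmxCM mxtrace_adj trmxCK.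
by case: (\tr _).
Qed.

(* Gram-Schmidt, one vector at a time. *)
Lemma exists_proj_span (s : seq Op) x : exists t, t \in <<s>>%VS /\
  forall w, w \in <<s>>%VS -> opdot t w = opdot x w.
Proof.
elim: s x => [|v s IHs] x.
  exists 0; rewrite mem0v; split=> // w; rewrite span_nil memv0 => /eqP ->.
  by rewrite !opdot0r.
have [p [ps pP]] := IHs v; have [t [ts tP]] := IHs x.
pose u := v - p.
have u_orth w : w \in <<s>>%VS -> opdot u w = 0.
  by move=> /pP; rewrite /u opdotDl opdotNl => ->; rewrite subrr.
have su : v = u + p by rewrite subrK.
have us : u \in <<v :: s>>%VS.
  rewrite span_cons rpredB //; first by apply: (subvP (addvSl _ _)); rewrite memv_line.
  exact: (subvP (addvSr _ _)).
have sub w : w \in <<s>>%VS -> w \in <<v :: s>>%VS.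
  by rewrite span_cons; exact: (subvP (addvSr _ _)).
clearbody u.
(* If u = 0, then v already lies in the span of s and t still works. Otherwise the error x - t is
   corrected along u, which is orthogonal to the old span. *)
have [u0|u0] := eqVneq (opdot u u) 0.
  have {}u0 := opdot_eq0 _ u0.
  exists t; split=> [|w]; first exact: sub.
  rewrite span_cons => /memv_addP [_ /vlineP [c ->] [w' w's ->]].
  by apply: tP; rewrite rpredD ?rpredZ // su u0 add0r.
exists (t + (opdot (x - t) u / opdot u u) *: u); split.
  by rewrite rpredD ?rpredZ // sub.
move=> w; rewrite span_cons => /memv_addP [_ /vlineP [c ->] [w' w's ->]].
have w''s : c *: p + w' \in <<s>>%VS by rewrite rpredD ?rpredZ.
rewrite su scalerDr -addrA [LHS]opdotDr [RHS]opdotDr; congr (_ + _); last first.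
  by rewrite [LHS]opdotDl tP // opdotZl (u_orth _ w''s) mulr0 addr0.
rewrite !opdotZr; congr (_ * _).
by rewrite [LHS]opdotDl opdotZl divfK // opdotDl opdotNl addrC subrK.
Qed.

Lemma exists_proj (S : set Op) x : S 0 ->
    (forall c y z, S y -> S z -> S (c *: y + z)) ->
  exists t, S t /\ forall w, S w -> opdot t w = opdot x w.
Proof.
move=> S0 SP; have [U SU] := vspace_of_set _ S0 SP.
have [t] := exists_proj_span (vbasis U) x.
rewrite (span_basis (vbasisP U)) => -[tU tP].
by exists t; split=> [|w /SU]; [exact/SU | exact: tP].
Qed.

End Pairing.

(** * The algebra, its differential forms, and the operators d and d^* *)

Section Geometry.
Context {R : realType} {n : nat} (G : geometry R n).
Local Notation Op := 'M[R[i]]_n.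
Local Notation alg := (alg G).
Local Notation da := (da G).
Local Notation Omega := (Omega G).
Implicit Types (a b c w : Op).

Lemma alg0 : alg 0.
Proof. by rewrite -(addNr 1%:M) -scaleN1r; apply: algP; exact: alg1. Qed.

Lemma algD a b : alg a -> alg b -> alg (a + b).
Proof. by rewrite -{2}[a]scale1r; exact: algP. Qed.

Lemma algZ z a : alg a -> alg (z *: a).
Proof. by move=> aA; rewrite -[_ *: _]addr0; apply: algP aA alg0. Qed.

Lemma algN a : alg a -> alg (- a).
Proof. by rewrite -scaleN1r; exact: algZ. Qed.

(* Left multiplication by a maps the finite-dimensional algebra injectively,
   hence surjectively, to itself. *)
Lemma alg_inv a : alg a -> a \in unitmx -> alg (invmx a).
Proof.
move=> aA aU; have [U UP] := vspace_of_set alg alg0 (@algP _ _ G).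
pose f : 'End(Op) := linfun (mulmx a).
have fU : (f @: U <= U)%VS.
  apply/subvP => _ /memv_imgP [b /UP bA ->]; rewrite lfunE /=.
  by apply/UP; exact: algM.
have kf : (U :&: lker f = 0)%VS.
  apply/eqP; rewrite -subv0; apply/subvP => b; rewrite memv_cap memv_ker lfunE.
  by case/andP=> _ /= /eqP ab0; rewrite memv0 -[b](mulKmx aU) ab0 mulmx0.
have : 1%:M \in (f @: U)%VS.
  have /eqP -> : (f @: U == U)%VS by rewrite eqEdim fU limg_dim_eq //=.
  by apply/UP; exact: alg1.
case/memv_imgP => b /UP bA; rewrite lfunE /= => ab1.
by rewrite -[invmx a]mulmx1 ab1 mulKmx.
Qed.

(** With the factor i absorbed, da is the plain commutator [K, a] with K antihermitian. *)
Definition idirac : Op := 'i *: dirac G.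
Local Notation K := idirac.

Lemma dirac_adj : (dirac G)^t* = dirac G.
Proof.
have D1 : (dirac G)^t* *m len G = 1%:M.
  by rewrite -[X in _ *m X](len_adj G) -trmxCM (mulmxV (len_unit G)) trmxC1.
by rewrite -[LHS]mulmx1 -(mulmxV (len_unit G)) mulmxA D1 mul1mx.
Qed.

Lemma idirac_adj : K^t* = - K.
Proof. by rewrite trmxCZ conjCi dirac_adj scaleNr. Qed.

Lemma daE a : da a = K *m a - a *m K.
Proof. by rewrite /Defs.da scalerBr -scalemxAl -scalemxAr. Qed.

(** Up to sign K^2 is the inverse of ds^2, and commuting with an invertible operator passes to its
    inverse. *)
Lemma idirac2_comm a : alg a -> K *m K *m a = a *m (K *m K).
Proof.
move=> aA; rewrite -scalemxAl -scalemxAr scalerA -scalemxAl -scalemxAr.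
congr (_ *: _); rewrite /dirac; have U := len_unit G; have := len2_comm aA.
set l := len G in U *; set D := invmx l => lC.
have E : l *m l *m (D *m D) = 1%:M by rewrite mulmxA mulmxK // mulmxV.
have E' : D *m D *m (l *m l) = 1%:M by rewrite mulmxA mulmxKV // mulVmx.
by rewrite -[a in LHS]mulmx1 -E (mulmxA a) -lC -(mulmxA (l *m l)) mulmxA E' mul1mx.
Qed.

Lemma da_linear z a b : da (z *: a + b) = z *: da a + da b.
Proof.
rewrite !daE mulmxDr mulmxDl -scalemxAl -scalemxAr scalerBr opprD !addrA.
by congr (_ + _); rewrite addrAC.
Qed.

Lemma daM a b : da (a *m b) = da a *m b + a *m da b.
Proof. by rewrite !daE mulmxBl mulmxBr !mulmxA addrA subrK. Qed.

Lemma da_adj a : (da a)^t* = da (a^t*).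
Proof. by rewrite !daE trmxCD trmxCN !trmxCM idirac_adj mulmxN mulNmx opprK addrC. Qed.

(** The anticommutator of K with [K, a] is [K^2, a], which vanishes. *)
Lemma idirac_da a : alg a -> K *m da a = - (da a *m K).
Proof.
move=> aA; rewrite daE mulmxBr mulmxBl !mulmxA idirac2_comm // opprB.
by rewrite mulmxA.
Qed.

Lemma daprod_nil : daprod G [::] = 1%:M.
Proof. by rewrite /daprod big_nil. Qed.

Lemma daprod_cons b (s : seq Op) : daprod G (b :: s) = da b *m daprod G s.
Proof. by rewrite /daprod big_cons. Qed.

Lemma idirac_daprod (s : seq Op) : (forall b, b \in s -> alg b) ->
  K *m daprod G s = (-1) ^+ size s *: (daprod G s *m K).
Proof.
elim: s => [|b s IHs] sA; first by rewrite daprod_nil expr0 scale1r mulmx1 mul1mx.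
rewrite daprod_cons mulmxA idirac_da; last first.
  by apply: sA; rewrite mem_head.
rewrite mulNmx -[X in - X]mulmxA IHs; last first.
  by move=> c cs; apply: sA; rewrite inE cs orbT.
by rewrite -scalemxAr exprS mulN1r scaleNr mulmxA.
Qed.

Lemma OmegaP k z w w' : Omega k w -> Omega k w' -> Omega k (z *: w + w').
Proof.
move=> [s [sA ->]] [s' [sA' ->]].
exists ([seq (z *: p.1, p.2) | p <- s] ++ s'); split.
  move=> p; rewrite mem_cat => /orP [/mapP [q qs ->]|]; last exact: sA'.
  by have [? ?] := sA _ qs; split=> //=; exact: algZ.
rewrite big_cat big_map scaler_sumr /=; congr (_ + _).
by apply: eq_bigr => p _; rewrite scalemxAl.
Qed.

Lemma Omega_zero k : Omega k 0.
Proof. by exists [::]; rewrite big_nil. Qed.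

Lemma OmegaD k w w' : Omega k w -> Omega k w' -> Omega k (w + w').
Proof. by rewrite -{2}[w]scale1r; exact: OmegaP. Qed.

Lemma OmegaZ k z w : Omega k w -> Omega k (z *: w).
Proof. by move=> wO; rewrite -[_ *: _]addr0; apply: OmegaP wO (Omega_zero k). Qed.

Lemma OmegaN k w : Omega k w -> Omega k (- w).
Proof. by rewrite -scaleN1r; exact: OmegaZ. Qed.

Lemma Omega_sum k (I : eqType) (s : seq I) (F : I -> Op) :
  (forall j, j \in s -> Omega k (F j)) -> Omega k (\sum_(j <- s) F j).
Proof.
move=> FO; rewrite big_seq; elim/big_ind: _ => //; first exact: Omega_zero.
exact: OmegaD.
Qed.

Lemma Omega_word k a (t : k.-tuple Op) : alg a -> (forall b, b \in t -> alg b) ->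
  Omega k (a *m daprod G t).
Proof.
move=> aA tA; exists [:: (a, t)]; rewrite big_seq1; split=> // p.
by rewrite inE => /eqP ->.
Qed.

Lemma Omega0E w : Omega 0 w <-> alg w.
Proof.
split=> [[s [sA ->]]|wA].
  rewrite big_seq; elim/big_ind: _ => [||p /sA [pA _]]; first exact: alg0.
    exact: algD.
  by rewrite tuple0 daprod_nil mulmx1.
have := @Omega_word 0 w [tuple] wA.
by rewrite daprod_nil mulmx1; apply=> b.
Qed.

Lemma OmegaMl k a w : alg a -> Omega k w -> Omega k (a *m w).
Proof.
move=> aA [s [sA ->]]; rewrite mulmx_sumr; apply: Omega_sum => p /sA [pA tA].
by rewrite mulmxA; apply: Omega_word => //; exact: algM.
Qed.

(** The Leibniz rule, in the form db a_0 = d(b a_0) - b da_0, brings the product back to words with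
    a single coefficient on the left. *)
Lemma OmegaS k b w : alg b -> Omega k w -> Omega k.+1 (da b *m w).
Proof.
move=> bA [s [sA ->]]; rewrite mulmx_sumr; apply: Omega_sum => p /sA [pA tA].
have consA c : alg c -> forall x, x \in [tuple of c :: p.2] -> alg x.
  by move=> cA x; rewrite inE => /orP [/eqP ->|/tA].
have -> : da b *m (p.1 *m daprod G p.2) =
    1%:M *m daprod G (b *m p.1 :: p.2) - b *m daprod G (p.1 :: p.2).
  rewrite !daprod_cons mul1mx daM mulmxDl -!mulmxA addrK //.
apply: OmegaD; last apply: OmegaN.
- apply: (@Omega_word k.+1 _ [tuple of b *m p.1 :: p.2]); first exact: alg1.
  by apply: consA; exact: algM.
- by apply: (@Omega_word k.+1 _ [tuple of p.1 :: p.2]) => //; exact: consA.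
Qed.

(** The right factor is absorbed at the last differential, and [OmegaS] then restores the preceding
    differentials one at a time. *)
Lemma OmegaMr k a w : alg a -> Omega k w -> Omega k (w *m a).
Proof.
move=> aA [s [sA ->]]; rewrite mulmx_suml; apply: Omega_sum => -[b t] /sA [/= bA tA].
rewrite -mulmxA; apply: OmegaMl => //; elim: k t tA {s sA} => [|k IHk] t tA.
  by rewrite tuple0 daprod_nil mul1mx; apply/Omega0E.
case/tupleP: t tA => c t tA; rewrite daprod_cons -mulmxA; apply: OmegaS.
  by apply: tA; rewrite mem_head.
by apply: IHk => x xt; apply: tA; rewrite inE xt orbT.
Qed.

Lemma Omega1_ind (P : Op -> Prop) : P 0 -> (forall w w', P w -> P w' -> P (w + w')) ->
  (forall a b, alg a -> alg b -> P (a *m da b)) -> forall w, Omega 1 w -> P w.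
Proof.
move=> P0 PD Pda w [s [sA ->]]; rewrite big_seq; elim/big_ind: _ => // -[a t].
move=> /sA [/= aA tA]; case/tupleP: t tA => b t tA.
rewrite tuple0 daprod_cons daprod_nil mulmx1; apply: Pda => //; exact: tA (mem_head _ _).
Qed.

Lemma Omega1_da a : alg a -> Omega 1 (da a).
Proof.
move=> aA; rewrite -[da a]mulmx1; apply: OmegaS => //; apply/Omega0E; exact: alg1.
Qed.

Lemma Omega1M k w w' : Omega 1 w -> Omega k w' -> Omega k.+1 (w *m w').
Proof.
move=> wO wO'; elim/Omega1_ind: w / wO => [|w1 w2 h1 h2|a b aA bA].
- by rewrite mul0mx; exact: Omega_zero.
- by rewrite mulmxDl; exact: OmegaD.
- by rewrite -mulmxA; apply: OmegaMl => //; exact: OmegaS.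
Qed.

Lemma Omega1_adj w : Omega 1 w -> Omega 1 (w^t*).
Proof.
elim/Omega1_ind => [|w1 w2 h1 h2|a b aA bA].
- by rewrite trmx0 map_mx0; exact: Omega_zero.
- by rewrite trmxCD; exact: OmegaD.
- rewrite trmxCM da_adj; apply: OmegaMr; first exact: alg_adj.
  by apply: Omega1_da; exact: alg_adj.
Qed.

(** The right side depends only on the operator that the words represent, so d is well defined. The
    sign comes from moving K across k differentials. *)
Lemma words_d k (s : seq (Op * k.-tuple Op)) : words G s ->
  \sum_(p <- s) da p.1 *m daprod G p.2 =
  K *m (\sum_(p <- s) p.1 *m daprod G p.2) -
  (-1) ^+ k *: ((\sum_(p <- s) p.1 *m daprod G p.2) *m K).
Proof.
move=> sA; rewrite mulmx_sumr mulmx_suml scaler_sumr -sumrB.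
apply: eq_big_seq => p /sA [pA tA]; rewrite daE mulmxBl -!mulmxA.
by rewrite idirac_daprod // size_tuple -scalemxAr.
Qed.

(* On forms of degree k, d is the graded commutator with iD, since iD
   anticommutes with every da. *)
Lemma dE k w : Omega k w -> d G k w = K *m w - (-1) ^+ k *: (w *m K).
Proof.
move=> [s [sA ws]]; apply: xget_unique.
  by exists s; split=> //; rewrite words_d // -ws.
by move=> w' [s' [sA' ws' ->]]; rewrite words_d // -ws'.
Qed.

Lemma d1E w : Omega 1 w -> d G 1 w = K *m w + w *m K.
Proof. by move=> /dE ->; rewrite expr1 scaleN1r opprK. Qed.

Lemma OmegaS_d k w : Omega k w -> Omega k.+1 (d G k w).
Proof.
move=> wO; rewrite (dE _ _ wO); case: wO => s [sA ->].
rewrite -words_d //; apply: Omega_sum => p /sA [pA tA]; apply: OmegaS => //.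
by rewrite -[daprod _ _]mul1mx; apply: Omega_word => //; exact: alg1.
Qed.

Lemma exists_proj_Omega k x :
  exists t, Omega k t /\ forall w, Omega k w -> opdot t w = opdot x w.
Proof. by apply: exists_proj (Omega_zero k) _ => z w w'; exact: OmegaP. Qed.

Lemma projP k x : Omega k (proj G k x) /\
  forall w, Omega k w -> opdot (proj G k x) w = opdot x w.
Proof. exact: xgetPex (exists_proj_Omega k x). Qed.

(** As K^* = -K, this is the adjoint of the graded commutator on all operators, before projection to
    forms. *)
Lemma d_adjoint k s w : Omega k w ->
  opdot s (d G k w) = opdot ((-1) ^+ k *: (s *m K) - K *m s) w.
Proof.
move=> /dE ->; rewrite opdotDr opdotNr opdotZr opdotDl opdotZl opdotNl.
rewrite (opdotMl K) (opdotMr K) idirac_adj mulmxN mulNmx !opdotNr mulrN opprK.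
by rewrite rmorphXn rmorphN1 addrC.
Qed.

(** Projecting the adjoint of [d_adjoint] to [Omega k] yields a witness, so the [xget] in [dstar]
    never falls back on its default. *)
Lemma dstarP k s : Omega k (dstar G k s) /\
  forall w, Omega k w -> opdot (dstar G k s) w = opdot s (d G k w).
Proof.
have [t [tO tP]] := exists_proj_Omega k ((-1) ^+ k *: (s *m K) - K *m s).
have ex : exists t, Omega k t /\ forall w, Omega k w -> opdot t w = opdot s (d G k w).
  by exists t; split=> // w wO; rewrite tP // d_adjoint.
exact: xgetPex ex.
Qed.

End Geometry.

(* The matrix identities below are stated over an abstract commutative ring:
   [ring] is far slower over R[i], where comparing atoms unfolds its operations. *)
Ltac mx_abel := apply/matrixP => i j; rewrite !(addmxE, oppmxE); ring.

(** * Algebraic identities for the curvature and its variation, with K = iD *)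

Section MatrixIdentities.
Context {C : comNzRingType} {n : nat}.
Implicit Types (t : C) (K P Q p l a b : 'M[C]_n).

(** Linearity of the curvature over the algebra, for P = Phi: in nabla applied twice to e a the
    mixed terms cancel, and what is left over is [K^2, a] = 0. *)
Lemma curvature_frame_expansion K P a : K *m K *m a = a *m (K *m K) ->
  P *m (P *m a + (K *m a - a *m K)) +
    (K *m (P *m a + (K *m a - a *m K)) + (P *m a + (K *m a - a *m K)) *m K) =
  (K *m P + P *m K + P *m P) *m a.
Proof.
rewrite !(mulmxDl, mulmxDr, mulmxN, mulNmx) !mulmxA => ->.
by mx_abel.
Qed.

(** The curvature form for the potential P + t p. The coefficient of t is the linear variation
    theta'. *)
Lemma curvature_line_expansion K P p t :
  K *m (P + t *: p) + (P + t *: p) *m K + (P + t *: p) *m (P + t *: p) =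
  K *m P + P *m K + P *m P + t *: (K *m p + p *m K + P *m p + p *m P) +
    t ^+ 2 *: (p *m p).
Proof.
rewrite !(mulmxDl, mulmxDr, =^~ scalemxAl, =^~ scalemxAr) expr2 -scalerA !scalerDr.
by mx_abel.
Qed.

Lemma section_line_expansion P p a b da db t :
  (P + t *: p) *m (a + t *: b) + (da + t *: db) =
  P *m a + da + t *: (P *m b + db + p *m a) + t ^+ 2 *: (p *m b).
Proof.
rewrite !(mulmxDl, mulmxDr, =^~ scalemxAl, =^~ scalemxAr) expr2 -scalerA !scalerDr.
by mx_abel.
Qed.

(** Here Q stands for Phi^* and the hypothesis is the hermitian condition on nabla. Multiplied by p,
    it replaces l K p + l P p by K l p - Q l p. *)
Lemma covariant_derivative_metric K P Q l p :
  K *m l - l *m K = l *m P + Q *m l ->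
  l *m (K *m p + p *m K + P *m p + p *m P) =
  K *m (l *m p) + l *m p *m K - Q *m (l *m p) + l *m p *m P.
Proof.
move=> /(congr1 (mulmx^~ p)); rewrite mulmxBl mulmxDl => h.
have -> : K *m (l *m p) = l *m K *m p + (l *m P *m p + Q *m l *m p).
  by rewrite -h mulmxA addrC subrK.
rewrite !mulmxDr !mulmxA.
by mx_abel.
Qed.

End MatrixIdentities.

(** * Coordinates in a basis e for sections, tensors, homomorphisms and curvature *)

Section Frame.
Context {R : realType} {n : nat} {G : geometry R n} {E : framed_module G}.
Context (T : tensors E) (e : E) (he : frames e).
Local Notation Op := 'M[R[i]]_n.
Local Notation alg := (alg G).
Local Notation Omega := (Omega G).
Local Notation da := (da G).
Local Notation tcoord := (tcoord e).
Implicit Types (a b w : Op) (x y : E).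

Lemma wedgeP x : alg (wedge e x) /\ x = act e (wedge e x).
Proof.
have ex : exists a, alg a /\ x = act e a.
  by have [a [aP _]] := frames_basis he x; exists a.
exact: xgetPex ex.
Qed.

Lemma alg_wedge x : alg (wedge e x).
Proof. by case: (wedgeP x). Qed.

Lemma wedgeK x : act e (wedge e x) = x.
Proof. by case: (wedgeP x). Qed.

Lemma wedge_act a : alg a -> wedge e (act e a) = a.
Proof.
move=> aA; have [b [_ bU]] := frames_basis he (act e a).
by rewrite -(bU _ (wedgeP _)); apply: bU.
Qed.

Lemma wedge_frame : wedge e e = 1%:M.
Proof. by rewrite -{2}[e]act1 wedge_act //; exact: alg1. Qed.

Lemma wedge_linear c x y : wedge e (c *: x + y) = c *: wedge e x + wedge e y.
Proof.
rewrite -{1}(wedgeK x) -{1}(wedgeK y) -act_linr; try exact: alg_wedge.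
by rewrite wedge_act //; apply: algP; exact: alg_wedge.
Qed.

Lemma wedge0 : wedge e 0 = 0.
Proof.
by have := wedge_linear (-1) 0 0; rewrite scaler0 addr0 scaleN1r addNr.
Qed.

Lemma wedgeZ c x : wedge e (c *: x) = c *: wedge e x.
Proof. by rewrite -[_ *: x]addr0 wedge_linear wedge0 addr0. Qed.

Lemma wedge_actr x a : alg a -> wedge e (act x a) = wedge e x *m a.
Proof.
move=> aA; have xA := alg_wedge x.
by rewrite -{1}(wedgeK x) actM // wedge_act //; exact: algM.
Qed.

Lemma tens_linear k c w w' : Omega k w -> Omega k w' ->
  tens T k e (c *: w + w') = c *: tens T k e w + tens T k e w'.
Proof. by case: (tens_balanced T k) => _ + _; apply. Qed.

Lemma tens_wedge k x w : Omega k w -> tens T k x w = tens T k e (wedge e x *m w).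
Proof.
by move=> wO; case: (tens_balanced T k) => _ _ <- //; rewrite ?wedgeK //; exact: alg_wedge.
Qed.

(** By the universal property, the balanced map sending (x, w) to [wedge e x *m w] factors through
    the tensor product and gives a left inverse of w |-> e (x) w. *)
Lemma tens_inj k w w' : Omega k w -> Omega k w' ->
  tens T k e w = tens T k e w' -> w = w'.
Proof.
move=> wO wO' eq_w.
have [|g gP] := @tens_universal _ _ _ _ T k Op (fun x w => wedge e x *m w).
  split=> [c x y v vO|c x v v' vO vO'|x a v aA vO].
  - by rewrite wedge_linear mulmxDl -scalemxAl.
  - by rewrite mulmxDr -scalemxAr.
  - by rewrite wedge_actr // mulmxA.
have := congr1 g eq_w; rewrite !gP //.
by rewrite wedge_frame !mul1mx.
Qed.

(** Balancing moves the coefficient of x into the form, so elementary tensors, and hence their sums,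
    are of the form e (x) w. *)
Lemma tcoordP k (t : T k) : Omega k (tcoord t) /\ t = tens T k e (tcoord t).
Proof.
have ex : exists w, Omega k w /\ t = tens T k e w.
  have [s [sO ->]] := tens_span t.
  rewrite big_seq; elim/big_ind: _ => [|_ _ [w [wO ->]] [w' [wO' ->]]|[x w] /sO /= wO].
  - exists 0; split; first exact: Omega_zero.
    have := @tens_linear k (-1) 0 0 (Omega_zero G k) (Omega_zero G k).
    by rewrite scaler0 addr0 scaleN1r addNr.
  - exists (w + w'); split; first exact: OmegaD.
    by rewrite -[w in RHS]scale1r tens_linear // scale1r.
  - exists (wedge e x *m w); split; first by apply: OmegaMl => //; exact: alg_wedge.
    exact: tens_wedge.
exact: xgetPex ex.
Qed.

Lemma Omega_tcoord k (t : T k) : Omega k (tcoord t).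
Proof. by case: (tcoordP k t). Qed.

Lemma tcoordK k (t : T k) : tens T k e (tcoord t) = t.
Proof. by case: (tcoordP k t). Qed.

Lemma tcoord_tens k w : Omega k w -> tcoord (tens T k e w) = w.
Proof.
move=> wO; apply: (tens_inj k) => //; first exact: Omega_tcoord.
exact: tcoordK.
Qed.

Lemma tcoord_inj k (t t' : T k) : tcoord t = tcoord t' -> t = t'.
Proof. by move=> eq_t; rewrite -(tcoordK k t) eq_t tcoordK. Qed.

Lemma tcoord_linear k c (t t' : T k) :
  tcoord (c *: t + t') = c *: tcoord t + tcoord t'.
Proof.
have [tO tO'] := (Omega_tcoord k t, Omega_tcoord k t').
rewrite -{1}(tcoordK k t) -{1}(tcoordK k t') -tens_linear //.
by rewrite tcoord_tens //; exact: OmegaP.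
Qed.

Lemma tcoordD k (t t' : T k) : tcoord (t + t') = tcoord t + tcoord t'.
Proof. by rewrite -[t in LHS]scale1r tcoord_linear scale1r. Qed.

Lemma tcoord0 k : tcoord (0 : T k) = 0.
Proof. by apply: (addrI (tcoord (0 : T k))); rewrite -tcoordD !addr0. Qed.

Lemma tcoordZ k c (t : T k) : tcoord (c *: t) = c *: tcoord t.
Proof. by rewrite -[_ *: t]addr0 tcoord_linear tcoord0 addr0. Qed.

Lemma tcoordN k (t : T k) : tcoord (- t) = - tcoord t.
Proof. by rewrite -scaleN1r tcoordZ scaleN1r. Qed.

Lemma tcoord_tensx k x w : Omega k w -> tcoord (tens T k x w) = wedge e x *m w.
Proof.
move=> wO; rewrite tens_wedge // tcoord_tens //.
by apply: OmegaMl => //; exact: alg_wedge.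
Qed.

Lemma tcoord_tact k (t : T k) a : alg a -> tcoord (tact t a) = tcoord t *m a.
Proof.
move=> aA; have tO := Omega_tcoord k t.
by rewrite -{1}(tcoordK k t) tact_tens // tcoord_tens //; exact: OmegaMr.
Qed.

Lemma hom_tcoordP k (g : E -> T k) : Defs.hom g <->
  exists2 w, Omega k w & forall x, tcoord (g x) = w *m wedge e x.
Proof.
split=> [[gl gA]|[w wO gE]].
  exists (tcoord (g e)); first exact: Omega_tcoord.
  move=> x; have xA := alg_wedge x.
  by rewrite -[in LHS](wedgeK x) gA // tcoord_tact.
split=> [c x y|x a aA]; apply: tcoord_inj.
  by rewrite tcoord_linear !gE wedge_linear mulmxDr -scalemxAr.
by rewrite tcoord_tact // !gE wedge_actr // mulmxA.
Qed.

(** This serves both generators of the dual module: b = 1 for [wedge] and b = lambda^-1 for [ehat].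
    Invertibility of b makes the coordinate unique. *)
Lemma hcoordE k (g : E -> T k) w b : Omega k w -> alg b -> b \in unitmx ->
  (forall x, tcoord (g x) = w *m wedge e x) ->
  hcoord e (fun x => b *m wedge e x) g = w *m invmx b.
Proof.
move=> wO bA bU gE; have bA' := alg_inv G _ bA bU.
apply: xget_unique.
  split; first exact: OmegaMr.
  apply: funext => x; apply: tcoord_inj; have xA := alg_wedge x.
  rewrite /tens_dual tcoord_tact; last exact: algM.
  by rewrite tcoord_tens ?gE ?mulmxA ?mulmxKV //; exact: OmegaMr.
move=> v [vO gv].
have := gE e; rewrite gv /tens_dual tcoord_tact; last first.
  by rewrite wedge_frame mulmx1.
by rewrite wedge_frame !mulmx1 tcoord_tens // => <-; rewrite mulmxK.
Qed.

Lemma hcoord_wedge k (g : E -> T k) w : Omega k w ->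
  (forall x, tcoord (g x) = w *m wedge e x) -> hcoord e (wedge e) g = w.
Proof.
move=> wO gE; have -> : wedge e = (fun x => 1%:M *m wedge e x).
  by apply: funext => x; rewrite mul1mx.
rewrite (hcoordE k g w) // ?unitmx1 ?invmx1 ?mulmx1 //; exact: alg1.
Qed.

Section Connection.
Context (nabla : E -> T 1%N) (conn : connection nabla).
Local Notation Phi := (potential e nabla).

Lemma Omega_potential : Omega 1 Phi.
Proof. exact: Omega_tcoord. Qed.

Lemma tcoord_connection x :
  tcoord (nabla x) = Phi *m wedge e x + da (wedge e x).
Proof.
have xA := alg_wedge x; have dO := Omega1_da G _ xA.
rewrite -{1}(wedgeK x) (proj2 conn) // tcoordD tcoord_tact // tcoord_tensx //.
by rewrite wedge_frame mul1mx.
Qed.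

Definition curvature_form : Op := d G 1 Phi + Phi *m Phi.

Lemma Omega_curvature_form : Omega 2 curvature_form.
Proof.
have PhiO := Omega_potential.
by apply: OmegaD; [exact: OmegaS_d | exact: Omega1M].
Qed.

Lemma tcoord_curvature x :
  tcoord (curvature e nabla x) = curvature_form *m wedge e x.
Proof.
have PhiO := Omega_potential; have xA := alg_wedge x.
have nO := Omega_tcoord 1 (nabla x).
rewrite /curvature /extension tcoord_tens; last first.
  by apply: OmegaD; [exact: Omega1M | exact: OmegaS_d].
rewrite /curvature_form !d1E // tcoord_connection daE.
by apply: curvature_frame_expansion; exact: idirac2_comm.
Qed.

End Connection.
End Frame.

(** * The hermitian metrics, and the terms of both field equations in coordinates *)

Section Hermitian.
Context {R : realType} {n : nat} {G : geometry R n} {E : framed_module G}.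
Context (T : tensors E) (L : E -> E -> 'M[R[i]]_n) (hL : hermitian_structure L).
Context (e : E) (he : frames e).
Local Notation Op := 'M[R[i]]_n.
Local Notation alg := (alg G).
Local Notation Omega := (Omega G).
Local Notation da := (da G).
Local Notation tcoord := (tcoord e).
Local Notation lam := (L e e).
Implicit Types (a b w : Op) (x y : E).

Lemma lam_alg : alg lam.
Proof. by have [] := hL e he. Qed.

Lemma lam_unit : lam \in unitmx.
Proof. by have [] := hL e he. Qed.

Lemma lam_adj : lam^t* = lam.
Proof. by have [_ []] := hL e he. Qed.

Lemma lamV_alg : alg (invmx lam).
Proof. exact: alg_inv lam_alg lam_unit. Qed.

Lemma herm_frameE x y : L x y = (wedge e y)^t* *m lam *m wedge e x.
Proof.
have [_ _ _ LM] := hL e he.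
rewrite -{1}(wedgeK e he x) -{1}(wedgeK e he y) LM //; exact: alg_wedge.
Qed.

Lemma edotE x y : edot L x y = opdot (lam *m wedge e x) (wedge e y).
Proof. by rewrite /edot herm_frameE /opdot mulmxA. Qed.

(** With u the difference of the coordinates, testing on y = e (lambda u) makes the squared norm of
    lambda u vanish, and lambda is invertible. *)
Lemma edot_inj x x' : (forall y, edot L x y = edot L x' y) -> x = x'.
Proof.
move=> eq_x; have [xA xA'] := (alg_wedge e he x, alg_wedge e he x').
pose u := wedge e x - wedge e x'.
have uA : alg (lam *m u).
  by apply: algM; [exact: lam_alg | apply: algD => //; exact: algN].
have lu0 : lam *m u = 0.
  apply: opdot_eq0; have := eq_x (act e (lam *m u)).
  rewrite !edotE wedge_act // => /eqP.
  by rewrite -subr_eq0 -opdotNl -opdotDl -mulmxBr => /eqP.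
have u0 : u = 0 by rewrite -[u](mulKmx lam_unit) lu0 mulmx0.
rewrite -(wedgeK e he x) -(wedgeK e he x'); congr (act e _).
by apply/eqP; rewrite -subr_eq0 -/u u0.
Qed.

Lemma hdotE k (g g' : E -> T k) w w' : Omega k w -> Omega k w' ->
    (forall x, tcoord (g x) = w *m wedge e x) ->
    (forall x, tcoord (g' x) = w' *m wedge e x) ->
  hdot L e g g' = opdot (w *m lam) (lam *m w').
Proof.
move=> wO wO' gE gE'; rewrite /hdot (hcoord_wedge T e he k g w) //.
rewrite (hcoord_wedge T e he k g' w') // /dual_form wedge_frame //.
by rewrite mul1mx trmxC1 mulmx1.
Qed.

Lemma dual_frame (z : E -> Op) x : dual z -> z x = z e *m wedge e x.
Proof.
by case=> _ _ zM; rewrite -{1}(wedgeK e he x) zM //; exact: alg_wedge.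
Qed.

Lemma hatE xi : hat T L e xi = (fun x => (wedge e xi)^t* *m ehat L e x).
Proof.
have xA := alg_wedge e he xi; have xA' := alg_adj xA; have lA := lamV_alg.
have hdot_dual z k (w : T k) g rho : dual z -> Omega k rho ->
    (forall x, tcoord (g x) = rho *m wedge e x) ->
    hdot L e (tens_dual w z) g = opdot (tcoord w *m z e *m lam) (lam *m rho).
  move=> zD rO gE; have zA : alg (z e) by case: zD.
  apply: hdotE => // [|x]; first by apply: OmegaMr => //; exact: Omega_tcoord.
  rewrite /tens_dual tcoord_tact //; last by case: zD.
  by rewrite (dual_frame z x zD) mulmxA.
apply: xget_unique.
  have zD : dual (fun x => (wedge e xi)^t* *m ehat L e x).
    split=> [x|c x y|x a aA]; rewrite /ehat.
    - by do !apply: algM => //; exact: alg_wedge.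
    - by rewrite wedge_linear // !mulmxDr -!scalemxAr.
    - by rewrite wedge_actr // !mulmxA.
  split=> // k w g /(hom_tcoordP T e he) [rho rO gE].
  rewrite (hdot_dual _ _ _ _ rho) // /tdot gE /ehat wedge_frame // mulmx1.
  by rewrite -!mulmxA mulVmx ?lam_unit // mulmx1 opdotMr trmxCK mulmxA.
(* Uniqueness is read off in degree zero: with omega = e (x) 1 and gamma of coordinate lambda^-1 u,
   the defining identity becomes [opdot u u = 0]. *)
move=> z [zD zP]; have zA : alg (z e) by case: zD.
pose u := z e *m lam - (wedge e xi)^t*.
have uA : alg u.
  by apply: algD; [apply: algM => //; exact: lam_alg | exact: algN].
have O1 : Omega 0 1%:M by apply/Omega0E; exact: alg1.
have rO : Omega 0 (invmx lam *m u) by apply/Omega0E; exact: algM.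
pose g x := tens T 0 e (invmx lam *m u *m wedge e x).
have gE x : tcoord (g x) = invmx lam *m u *m wedge e x.
  by rewrite tcoord_tens //; apply: OmegaMr => //; exact: alg_wedge.
have gH : Defs.hom g by apply/(hom_tcoordP T e he); exists (invmx lam *m u).
have := zP _ (tens T 0 e 1%:M) _ gH.
rewrite (hdot_dual _ _ _ _ _ zD rO gE) /tdot gE tcoord_tens // mul1mx.
rewrite (mulmxA lam) mulKVmx ?lam_unit // -[X in u *m X]trmxCK -opdotMr mul1mx.
move/esym/eqP; rewrite -subr_eq0 -opdotNl -opdotDl => /eqP /opdot_eq0 /eqP.
rewrite subr_eq0 => /eqP zl; apply: funext => x.
by rewrite (dual_frame z x zD) -zl /ehat mulmxA mulmxK ?lam_unit.
Qed.

Lemma nabla_starP (nabla : E -> T 1%N) (t : T 1%N) : connection nabla ->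
  forall y, edot L (nabla_star L e nabla t) y = tdot L e t (nabla y).
Proof.
move=> conn; pose Phi := potential e nabla; pose s := lam *m tcoord t.
(* The operator is the adjoint of a |-> Phi a + [K, a] applied to s; b is its projection to the
   algebra. The section sought is e (lambda^-1 b), as [edot] carries a factor lambda. *)
have [b [bO bP]] := exists_proj_Omega G 0 (Phi^t* *m s + (s *m idirac G - idirac G *m s)).
have bA : alg b by apply/Omega0E.
have ex : exists x, forall y, edot L x y = tdot L e t (nabla y).
  exists (act e (invmx lam *m b)) => y; have yA := alg_wedge e he y.
  rewrite edotE // wedge_act //; last by apply: algM => //; exact: lamV_alg.
  rewrite mulKVmx ?lam_unit // bP; last by apply/Omega0E.
  rewrite /tdot (tcoord_connection T e he _ conn) -{1}lam_adj -opdotMl -/s opdotDl opdotDr.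
  rewrite opdotMl trmxCK; congr (_ + _).
  rewrite daE opdotDl opdotDr !opdotNl !opdotNr (opdotMl (idirac G)) (opdotMr (idirac G)).
  by rewrite idirac_adj mulmxN mulNmx !opdotNr opprK addrC.
exact: xgetPex ex.
Qed.

Lemma nabla_star_eq (nabla : E -> T 1%N) (t : T 1%N) x : connection nabla ->
  nabla_star L e nabla t = x <-> forall y, edot L x y = tdot L e t (nabla y).
Proof.
move=> conn; have nP := nabla_starP nabla t conn.
split=> [<- //|xP]; apply: edot_inj => y; by rewrite nP xP.
Qed.

Section Connection.
Context (nabla : E -> T 1%N) (hn : hermitian_connection L e nabla).
Local Notation Phi := (potential e nabla).
Local Notation theta := (curvature_form T e nabla).

(** This is the form omega for sigma = theta lambda, projected to one-forms. Pairings with one-forms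
    do not see the projection. *)
Definition YM_gradient : Op :=
  proj G 1 (dstar G 1 (theta *m lam) + theta *m lam *m Phi^t* - Phi *m (theta *m lam)).

Lemma tcoord_dnabla_star x :
  tcoord (dnabla_star L e nabla (curvature e nabla) x) =
  (YM_gradient - YM_gradient^t*) *m ehat L e x.
Proof.
have conn := proj1 hn; have thO := Omega_curvature_form T e he nabla.
have gO : Omega 1 YM_gradient by exact: proj1 (projP G 1 _).
(* Since [ehat] carries lambda^-1, the coordinate of the curvature along it is theta lambda. *)
rewrite /dnabla_star (hcoordE T e he 2 _ theta) //; first last.
- exact: tcoord_curvature.
- by rewrite unitmx_inv lam_unit.
- exact: lamV_alg.
rewrite invmxK -/YM_gradient /tens_dual tcoord_tact //; last first.
  by apply: algM; [exact: lamV_alg | exact: alg_wedge].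
rewrite tcoord_tens //; apply: OmegaD => //.
by apply: OmegaN; exact: Omega1_adj.
Qed.

(** The form of nabla^ xi^ along [ehat] is d a^* + a^* Phi^* = (Phi a + da)^*, the adjoint of the
    form of nabla xi. *)
Lemma tcoord_current xi x :
  tcoord (current L e nabla xi x) =
  (tcoord (nabla xi) *m (wedge e xi)^t* - wedge e xi *m (tcoord (nabla xi))^t*)
    *m ehat L e x.
Proof.
have conn := proj1 hn; have xA := alg_wedge e he xi; have xA' := alg_adj xA.
have eA y : alg (ehat L e y).
  by apply: algM; [exact: lamV_alg | exact: alg_wedge].
have PhiO : Omega 1 Phi by exact: Omega_tcoord.
rewrite /current hatE /nabla_hat.
rewrite (_ : xget 0 _ = (wedge e xi)^t*); last first.
  apply: xget_unique => // b [bA /(congr1 (fun f => f e))].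
  rewrite /ehat wedge_frame // mulmx1 => /(congr1 (mulmx^~ lam)).
  by rewrite !mulmxKV ?lam_unit.
rewrite tcoordD // tcoordN // tcoord_tact //; last exact: algM.
rewrite tcoord_tensx //; last first.
  apply: OmegaMr => //; apply: OmegaD; first exact: Omega1_da.
  by apply: OmegaMl => //; exact: Omega1_adj.
rewrite [in RHS]mulmxDl mulNmx !mulmxA; congr (_ - _); do 2 congr (_ *m _).
by rewrite [in RHS]tcoord_connection // trmxCD trmxCM da_adj mulmxDr mulmxDr addrC mulmxA.
Qed.

End Connection.
End Hermitian.

(** * Derivatives of real quadratic forms along curves *)

Section Variation.
Context {R : realType}.

Lemma ReD (x y : R[i]) : complex.Re (x + y) = complex.Re x + complex.Re y.
Proof. by case: x y => [? ?] [? ?]. Qed.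

Lemma ReN (x : R[i]) : complex.Re (- x) = - complex.Re x.
Proof. by case: x. Qed.

Lemma ReZ (t : R) (x : R[i]) : complex.Re (t%:C * x) = t * complex.Re x.
Proof. by case: x => a b /=; rewrite mul0r subr0. Qed.

(** Each term of the action is a real quadratic form on a curve of degree at most two in t. It
    expands to a quartic polynomial whose linear coefficient is 2 Q(x0, x1). *)
Lemma is_derive_quadratic (V : lmodType R[i]) (Q : V -> V -> R) :
    (forall x y z, Q (x + y) z = Q x z + Q y z) ->
    (forall t x y, Q (t%:C *: x) y = t * Q x y) ->
    (forall x y, Q x y = Q y x) ->
  forall x0 x1 x2, is_derive (0 : R) (1 : R)
    (fun t => let x := x0 + t%:C *: x1 + (t ^+ 2)%:C *: x2 in Q x x) (2 * Q x0 x1).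
Proof.
move=> QD QZ QC x0 x1 x2.
have QDr x y z : Q x (y + z) = Q x y + Q x z by rewrite QC QD !(QC _ x).
have QZr t x y : Q x (t%:C *: y) = t * Q x y by rewrite QC QZ (QC _ x).
pose p : {poly R} := (Q x0 x0)%:P + (2 * Q x0 x1) *: 'X +
  (2 * Q x0 x2 + Q x1 x1) *: 'X^2 + (2 * Q x1 x2) *: 'X^3 + (Q x2 x2) *: 'X^4.
have -> : (fun t => let x := x0 + t%:C *: x1 + (t ^+ 2)%:C *: x2 in Q x x) = horner p.
  apply: funext => t /=; rewrite /p !(hornerD, hornerC, hornerZ, hornerX, hornerXn) !(QD, QZ, QDr, QZr).
  rewrite (QC x1 x0) (QC x2 x0) (QC x2 x1); ring.
have <- : (deriv p).[0] = 2 * Q x0 x1; last exact: is_derive_poly.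
rewrite /p !(derivD, derivC, derivZ, derivX, derivXn) !(hornerD, hornerC, hornerZ, hornerMn, hornerX, hornerXn).
ring.
Qed.

Lemma is_derive_lin3 (f g h : R -> R) c df dg dh :
  is_derive (0 : R) (1 : R) f df -> is_derive (0 : R) (1 : R) g dg ->
  is_derive (0 : R) (1 : R) h dh ->
  is_derive (0 : R) (1 : R) (fun t : R => f t + g t - c * h t) (df + dg - c * dh).
Proof.
move=> fd gd hd; exact: (is_deriveB (is_deriveD fd gd) (is_deriveZ c hd)).
Qed.

End Variation.

(** * The first variation of the action and its critical points *)

Section EulerLagrange.
Context {R : realType} {n : nat} {G : geometry R n} {E : framed_module G}.
Context (T : tensors E) (L : E -> E -> 'M[R[i]]_n) (hL : hermitian_structure L).
Context (e : E) (he : frames e) (nabla : E -> T 1%N).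
Context (hn : hermitian_connection L e nabla) (xi : E).
Local Notation Op := 'M[R[i]]_n.
Local Notation alg := (alg G).
Local Notation Omega := (Omega G).
Local Notation da := (da G).
Local Notation tcoord := (tcoord e).
Local Notation lam := (L e e).
Local Notation Phi := (potential e nabla).
Local Notation theta := (curvature_form T e nabla).
Local Notation a := (wedge e xi).
Local Notation w := (tcoord (nabla xi)).
Implicit Types (t : R) (phi b : Op).

Definition curvature_variation phi : Op := d G 1 phi + Phi *m phi + phi *m Phi.

(** The form along [ehat] of d_nabla^* nabla^2 + J; the first equation says that it vanishes. *)
Definition field_residual : Op :=
  (YM_gradient T L e nabla - (YM_gradient T L e nabla)^t* ) +
  (w *m a^t* - a *m w^t* ).

Definition admissible phi : Prop :=
  Omega 1 phi /\ lam *m phi + phi^t* *m lam = 0.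

Let conn : connection nabla := proj1 hn.

(** Subtracting the Leibniz rules of two connections cancels the da terms, so dnabla is linear over
    the algebra. Subtracting the hermitian conditions cancels d lambda. *)
Lemma admissible_variation (dnabla : E -> T 1%N) :
    hermitian_connection L e (fun x => nabla x + dnabla x) ->
  exists2 phi, admissible phi & forall x, tcoord (dnabla x) = phi *m wedge e x.
Proof.
move=> [[cl cA]]; rewrite {1 2}/potential tcoordD // => hlam.
exists (tcoord (dnabla e)); first split; first exact: Omega_tcoord.
  have := proj2 hn; rewrite hlam /potential mulmxDr trmxCD mulmxDl.
  move=> h; apply: (addrI (lam *m tcoord (nabla e) + (tcoord (nabla e))^t* *m lam)).
  by rewrite addr0 -[RHS]h addrACA.
move=> x; have xA := alg_wedge e he x.
have /(congr1 (@Defs.tcoord _ _ _ _ T e 1)) := cA e _ xA; rewrite wedgeK //.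
rewrite !(tcoordD, tcoord_tact) // (tcoord_connection T e he _ conn x) tcoord_tensx //; last first.
  exact: Omega1_da.
rewrite wedge_frame // mul1mx mulmxDl addrAC => h.
exact: (addrI _ (addIr _ h)).
Qed.

Lemma variation_admissible phi : admissible phi ->
  hermitian_connection L e (fun x => nabla x + tens T 1 e (phi *m wedge e x)).
Proof.
move=> [pO ph]; have [cl cA] := conn.
have pxO x : Omega 1 (phi *m wedge e x) by apply: OmegaMr => //; exact: alg_wedge.
split; first split.
- move=> c x y; rewrite cl wedge_linear // mulmxDr -scalemxAr tens_linear //.
  by rewrite scalerDr addrACA.
- move=> x b bA; apply: (tcoord_inj T e he).
  rewrite cA // !(tcoordD, tcoord_tact) // !tcoord_tens //.
  by rewrite wedge_actr // mulmxA mulmxDl addrAC.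
rewrite /potential tcoordD // tcoord_tens // wedge_frame // mulmx1.
by rewrite mulmxDr trmxCD mulmxDl addrACA ph addr0; exact: (proj2 hn).
Qed.

Lemma YM_E (nabla' : E -> T 1%N) : connection nabla' ->
  YM L e nabla' = complex.Re (opdot (curvature_form T e nabla' *m lam)
                                    (lam *m curvature_form T e nabla')).
Proof.
move=> conn'; have thO := Omega_curvature_form T e he nabla'.
by rewrite /YM (hdotE T L e he 2 _ _ _ _ thO thO) //; exact: tcoord_curvature.
Qed.

Lemma connection_line (dnabla : E -> T 1%N) phi t :
    Omega 1 phi -> (forall x, tcoord (dnabla x) = phi *m wedge e x) ->
  connection (fun x => nabla x + t%:C *: dnabla x).
Proof.
move=> pO dE; have [cl cA] := conn.
split=> [c x y|x b bA]; apply: (tcoord_inj T e he).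
  rewrite cl !(tcoordD, tcoordZ, tcoord_linear) // !dE wedge_linear //.
  by rewrite mulmxDr -scalemxAr !scalerDr !scalerA addrACA (mulrC c).
rewrite cA // !(tcoordD, tcoordZ, tcoord_tact) // !dE.
by rewrite wedge_actr // mulmxDl -scalemxAl mulmxA addrAC.
Qed.

Lemma derive_action m (dnabla : E -> T 1%N) dxi phi :
    Omega 1 phi -> (forall x, tcoord (dnabla x) = phi *m wedge e x) ->
  is_derive (0 : R) (1 : R)
    (fun t : R => action L e m (fun x => nabla x + t%:C *: dnabla x) (xi + t%:C *: dxi))
    (2 * complex.Re (opdot (theta *m lam) (lam *m curvature_variation phi)) +
     2 * complex.Re (opdot w (lam *m (Phi *m wedge e dxi + da (wedge e dxi) + phi *m a)))
     - m ^+ 2 * (2 * complex.Re (opdot (lam *m a) (wedge e dxi)))).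
Proof.
move=> pO dE; set b := wedge e dxi.
have lamC := lam_adj L hL e he.
(* [Q1], [Q2] and [Q3] polarize the Yang-Mills, energy and norm terms. They are symmetric because
   lambda is selfadjoint. *)
pose Q1 (x y : Op) := complex.Re (opdot (x *m lam) (lam *m y)).
pose Q2 (x y : Op) := complex.Re (opdot x (lam *m y)).
pose Q3 (x y : Op) := complex.Re (opdot (lam *m x) y).
have Q1C x y : Q1 x y = Q1 y x.
  by rewrite /Q1 Re_opdotC opdotMl lamC (opdotMr lam y) lamC mulmxA.
have Q2C x y : Q2 x y = Q2 y x by rewrite /Q2 Re_opdotC opdotMl lamC.
have Q3C x y : Q3 x y = Q3 y x by rewrite /Q3 Re_opdotC opdotMl lamC.
have Q1D x y z : Q1 (x + y) z = Q1 x z + Q1 y z.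
  by rewrite /Q1 mulmxDl opdotDl ReD.
have Q2D x y z : Q2 (x + y) z = Q2 x z + Q2 y z by rewrite /Q2 opdotDl ReD.
have Q3D x y z : Q3 (x + y) z = Q3 x z + Q3 y z.
  by rewrite /Q3 mulmxDr opdotDl ReD.
have Q1Z t x y : Q1 (t%:C *: x) y = t * Q1 x y.
  by rewrite /Q1 -scalemxAl opdotZl ReZ.
have Q2Z t x y : Q2 (t%:C *: x) y = t * Q2 x y by rewrite /Q2 opdotZl ReZ.
have Q3Z t x y : Q3 (t%:C *: x) y = t * Q3 x y.
  by rewrite /Q3 -scalemxAr opdotZl ReZ.
have D1 := is_derive_quadratic Op Q1 Q1D Q1Z Q1C theta (curvature_variation phi) (phi *m phi).
have D2 := is_derive_quadratic Op Q2 Q2D Q2Z Q2C w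
             (Phi *m b + da b + phi *m a) (phi *m b).
(* The coordinate of the section is affine in t, hence the zero quadratic coefficient. *)
have D3 := is_derive_quadratic Op Q3 Q3D Q3Z Q3C a b 0.
have {D1 D2 D3} := is_derive_lin3 _ _ _ (m ^+ 2) _ _ _ D1 D2 D3.
congr (is_derive _ _ _ _); apply: funext => t /=; rewrite /action.
have tX : (t ^+ 2)%:C = t%:C ^+ 2 by rewrite rmorphXn.
have pt : potential e (fun x => nabla x + t%:C *: dnabla x) = Phi + t%:C *: phi.
  by rewrite /potential tcoordD // tcoordZ // dE wedge_frame // mulmx1.
have ct := connection_line dnabla phi t pO dE.
have xt : wedge e (xi + t%:C *: dxi) = a + t%:C *: b.
  by rewrite addrC wedge_linear // addrC.
have e1 : YM L e (fun x => nabla x + t%:C *: dnabla x) =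
    Q1 (theta + t%:C *: curvature_variation phi + (t ^+ 2)%:C *: (phi *m phi))
       (theta + t%:C *: curvature_variation phi + (t ^+ 2)%:C *: (phi *m phi)).
  rewrite (YM_E _ ct) /curvature_form /curvature_variation pt (d1E _ _ (Omega_potential T e he nabla)) (d1E _ _ pO) d1E.
    by rewrite curvature_line_expansion -tX.
  by apply: OmegaD; [exact: (Omega_potential T e he nabla) | exact: OmegaZ].
have e2 : energy L e (fun x => nabla x + t%:C *: dnabla x) (xi + t%:C *: dxi) =
    Q2 (w + t%:C *: (Phi *m b + da b + phi *m a) + (t ^+ 2)%:C *: (phi *m b))
       (w + t%:C *: (Phi *m b + da b + phi *m a) + (t ^+ 2)%:C *: (phi *m b)).
  rewrite /energy /tdot (tcoord_connection T e he _ ct) pt xt.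
  rewrite (tcoord_connection T e he _ conn xi).
  rewrite (addrC a) da_linear (addrC _ (da a)) (addrC _ a).
  by rewrite section_line_expansion -tX.
have e3 : sqnorm L (xi + t%:C *: dxi) =
    Q3 (a + t%:C *: b + (t ^+ 2)%:C *: 0) (a + t%:C *: b + (t ^+ 2)%:C *: 0).
  rewrite /sqnorm (edotE L hL e he) xt scaler0 addr0; exact: erefl.
by rewrite e1 e2 e3.
Qed.

Lemma metric_curvature_variation phi : Omega 1 phi ->
  lam *m curvature_variation phi = d G 1 (lam *m phi) - Phi^t* *m (lam *m phi) + lam *m phi *m Phi.
Proof.
move=> pO; have lA := lam_alg L hL e he.
rewrite /curvature_variation (d1E _ _ pO) d1E; last exact: OmegaMl.
apply: covariant_derivative_metric; rewrite -daE; exact: proj2 hn.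
Qed.

Lemma variation_pairing phi : admissible phi ->
  2 * complex.Re (opdot (theta *m lam) (lam *m curvature_variation phi)) +
  2 * complex.Re (opdot w (lam *m (phi *m a))) =
  complex.Re (opdot field_residual (lam *m phi)).
Proof.
move=> [pO ph]; have lA := lam_alg L hL e he; have lamC := lam_adj L hL e he.
have bO : Omega 1 (lam *m phi) by exact: OmegaMl.
have bC : (lam *m phi)^t* = - (lam *m phi).
  by apply/eqP; rewrite -addr_eq0 trmxCM lamC addrC ph.
rewrite metric_curvature_variation // (mulmxA lam); set beta := lam *m phi in bO bC *.
(* The residual is twice the antihermitian part of X. As beta is antihermitian, pairing it with the
   residual gives 2 Re <X, beta>, which accounts for the factors 2 on the left. *)
pose X := YM_gradient T L e nabla + w *m a^t*.
have -> : field_residual = X - X^t*.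
  rewrite /field_residual /X trmxCD trmxCM trmxCK; move: (YM_gradient _ _ _ _) => g.
  by rewrite opprD addrACA.
have -> : complex.Re (opdot (X - X^t*) beta) = 2 * complex.Re (opdot X beta).
  rewrite opdotDl opdotNl -[in X in _ - X](opprK beta) -bC opdotNr opprK.
  by rewrite ReD Re_opdot_adj mulr_natl mulr2n.
rewrite -mulrDr -ReD; congr (2 * complex.Re _).
rewrite /X opdotDl; congr (_ + _); last by rewrite opdotMr trmxCK.
(* Against the one-form beta the projection drops out and d^* becomes d on the other side. *)
rewrite (proj2 (projP G 1 _)) // !opdotDl opdotNl (proj2 (dstarP G 1 _)) //.
rewrite !opdotDr opdotNr (opdotMl Phi) (opdotMr (Phi^t* )) trmxCK.
by rewrite addrAC.
Qed.

Lemma field_equation_residual :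
  (forall x, dnabla_star L e nabla (curvature e nabla) x = - current L e nabla xi x)
    <-> field_residual = 0.
Proof.
have sE x : tcoord (dnabla_star L e nabla (curvature e nabla) x + current L e nabla xi x) =
    field_residual *m ehat L e x.
  by rewrite tcoordD // tcoord_dnabla_star // tcoord_current // -mulmxDl.
split=> [eq_s|s0 x]; last first.
  apply/eqP; rewrite -addr_eq0; apply/eqP; apply: (tcoord_inj T e he).
  by rewrite sE s0 mul0mx tcoord0.
have := sE e; rewrite eq_s addNr tcoord0 // /ehat wedge_frame // mulmx1.
move=> /esym /(congr1 (mulmx^~ lam)); rewrite mulmxKV ?mul0mx //.
exact: lam_unit.
Qed.

(** The residual is antihermitian by construction, so it may serve as beta = lambda phi in a test
    variation. *)
Lemma field_residual_admissible : admissible (invmx lam *m field_residual) .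
Proof.
have lamC := lam_adj L hL e he; have lU := lam_unit L hL e he.
have aA := alg_wedge e he xi; have aA' := alg_adj aA.
have wO := Omega_tcoord T e he 1 (nabla xi).
have gO : Omega 1 (YM_gradient T L e nabla) by exact: proj1 (projP G 1 _).
split.
  apply: OmegaMl; first exact: lamV_alg.
  apply: OmegaD; apply: OmegaD; try apply: OmegaN.
  - exact: gO.
  - exact: Omega1_adj.
  - exact: OmegaMr.
  - by apply: OmegaMl => //; exact: Omega1_adj.
have -> : (invmx lam *m field_residual)^t* *m lam = field_residual^t*.
  by rewrite -[X in _ *m X = _]lamC -trmxCM mulKVmx.
rewrite mulKVmx // /field_residual !(trmxCD, trmxCN, trmxCM, trmxCK).
move: (YM_gradient _ _ _ _) (w *m _) (a *m _) => g x y.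
by rewrite -(opprB g) -(opprB x y) -opprD subrr.
Qed.

(** This form separates the variations: the first term involves only phi and the second only dxi. *)
Lemma action_variation m (dnabla : E -> T 1%N) dxi phi :
    admissible phi -> (forall x, tcoord (dnabla x) = phi *m wedge e x) ->
  is_derive (0 : R) (1 : R)
    (fun t : R => action L e m (fun x => nabla x + t%:C *: dnabla x) (xi + t%:C *: dxi))
    (complex.Re (opdot field_residual (lam *m phi)) +
     2 * complex.Re (tdot L e (nabla xi) (nabla dxi) - edot L ((m ^+ 2)%:C *: xi) dxi)).
Proof.
move=> pA dE; have [pO _] := pA.
apply: is_derive_eq (derive_action m dnabla dxi phi pO dE) _.
rewrite -variation_pairing // mulmxDr opdotDr ReD ReD ReN (edotE L hL e he) wedgeZ //.
rewrite -scalemxAr opdotZl ReZ /tdot (tcoord_connection T e he _ conn dxi).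
suff collect (x y z u : R) : 2 * x + 2 * (y + z) - m ^+ 2 * (2 * u) =
    2 * x + 2 * z + 2 * (y - m ^+ 2 * u) by exact: collect.
by ring.
Qed.

Lemma euler_lagrangeP m : euler_lagrange L e m nabla xi <->
  field_residual = 0 /\
  forall y, edot L ((m ^+ 2)%:C *: xi) y = tdot L e (nabla xi) (nabla y).
Proof.
pose gap y := tdot L e (nabla xi) (nabla y) - edot L ((m ^+ 2)%:C *: xi) y.
split=> [el|[s0 gap0] dnabla dxi /admissible_variation [phi pA dE]]; last first.
  apply: is_derive_eq (action_variation m dnabla dxi phi pA dE) _.
  by rewrite s0 gap0 subrr /opdot mulmx0 linear0 !(raddf0, mulr0, addr0).
have crit phi y : admissible phi ->
    complex.Re (opdot field_residual (lam *m phi)) + 2 * complex.Re (gap y) = 0.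
  move=> pA; have pO := proj1 pA.
  have dE x : tcoord (tens T 1 e (phi *m wedge e x)) = phi *m wedge e x.
    by rewrite tcoord_tens //; apply: OmegaMr => //; exact: alg_wedge.
  have D1 := action_variation m _ y phi pA dE.
  have D2 := el _ y (variation_admissible phi pA).
  by rewrite -(derive_val (is_derive := D1)) (derive_val (is_derive := D2)).
(* Keeping the connection fixed isolates the variation of the section. *)
have adm0 : admissible 0.
  by split; [exact: Omega_zero | rewrite mulmx0 trmx0 map_mx0 mul0mx addr0].
have Re_gap y : complex.Re (gap y) = 0.
  have := crit 0 y adm0; rewrite mulmx0 opdot0r /= add0r => /eqP.
  by rewrite mulf_eq0 pnatr_eq0 => /eqP.
split.
  (* For this phi the product lambda phi is the residual itself, so its squared norm vanishes. *)
  apply: opdot_Re0; have := crit _ 0 field_residual_admissible.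
  rewrite Re_gap mulr0 addr0 mulKVmx //; exact: lam_unit.
move=> y; apply/esym/eqP; rewrite -subr_eq0 -/(gap y); apply/eqP.
have gapZ c : gap (c *: y) = (c^*)%R * gap y.
  have nablaZ : nabla (c *: y) = c *: nabla y.
    have [nl _] := conn; have n0 : nabla 0 = 0.
      by have := nl (-1) 0 0; rewrite scaler0 addr0 scaleN1r addNr.
    by have := nl c y 0; rewrite n0 !addr0.
  rewrite /gap /tdot !(edotE L hL e he) nablaZ tcoordZ // wedgeZ // -scalemxAr.
  by rewrite !opdotZr mulrBr.
(* Conjugate linearity gives gap(i y) = -i gap(y), whose real part is the imaginary part of
   gap(y). *)
have := Re_gap (0 +i* 1 *: y); rewrite gapZ; have := Re_gap y.
case: (gap y) => u v /= ->.
by rewrite !mul0r mulN1r sub0r opprK => ->.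
Qed.

End EulerLagrange.

Theorem theorem8p2 (R : realType) (n : nat) (G : geometry R n)
    (E : framed_module G) (T : tensors E)
    (Lambda : E -> E -> 'M[R[i]]_n) (hLambda : hermitian_structure Lambda)
    (e : E) (he : frames e) (m : R)
    (nabla : E -> T 1%N) (hnabla : hermitian_connection Lambda e nabla)
    (xi : E) :
  euler_lagrange Lambda e m nabla xi <->
  (forall x : E,
     dnabla_star Lambda e nabla (curvature e nabla) x
       = - current Lambda e nabla xi x) /\
  nabla_star Lambda e nabla (nabla xi) = (m ^+ 2)%:C *: xi.
Proof.
have sP := field_equation_residual T Lambda hLambda e he nabla hnabla xi.
have nP := nabla_star_eq T Lambda hLambda e he nabla (nabla xi) ((m ^+ 2)%:C *: xi)
             (proj1 hnabla).
have elP := euler_lagrangeP T Lambda hLambda e he nabla hnabla xi m.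
split=> [/elP [s0 gap0]|[/sP s0 /nP gap0]]; first by split; [exact/sP | exact/nP].
by apply/elP; split.
Qed.
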